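(* Let $n>1$. There is a Borel graph homomorphism from the directed Schreier graph $\vec F(2^{\mathbb Z^n})$ to the regular tournament $P_5$ on $5$ vertices, where $V(P_5)=\mathbb Z_5$ and $i\to j$ is an arc of $P_5$ if and only if $j-i\equiv 1$ or $2 \pmod 5$.
   Context: A graph homomorphism between directed graphs is a map of vertices sending every arc to an arc. $2^{\mathbb Z^n}=\{0,1\}^{\mathbb Z^n}$ carries the product topology and the shift action $(g\cdot x)(h)=x(h+g)$ for $g,h\in\mathbb Z^n$. Its free part is $F(2^{\mathbb Z^n})=\{x: g\cdot x\neq x \text{ for every } g\neq 0\}$, a Polish space. With $e_1,\dots,e_n$ the standard generators of $\mathbb Z^n$, the directed Schreier graph $\vec F(2^{\mathbb Z^n})$ has vertex set $F(2^{\mathbb Z^n})$ and arcs $x\to e_i\cdot x$ for all $x$ and $1\le i\le n$. *)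

(* Defs.v *)
From HB Require Import structures.
From mathcomp Require Import all_boot all_order all_algebra.
From mathcomp Require Import all_classical all_reals all_analysis.

Set Implicit Arguments.
Unset Strict Implicit.
Unset Printing Implicit Defensive.

Import GRing.Theory.
Local Open Scope classical_set_scope.
Local Open Scope ring_scope.

Definition borel (X : topologicalType) : set (set X) := <<s open >>.

Definition borel_map (X Y : topologicalType) (f : X -> Y) : Prop :=
  forall B : set Y, borel B -> borel (f @^-1` B).

Definition digraph_hom (V W : Type) (E : V -> V -> Prop) (E' : W -> W -> Prop)
    (f : V -> W) : Prop :=
  forall x y : V, E x y -> E' (f x) (f y).

(* [bool] is discrete in the library, so this is {0,1}^(Z^n) with the product
   topology. *)
Definition cantor_shift (n : nat) : topologicalType :=
  {ptws 'rV[int]_n -> bool}.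

Definition shift_act (n : nat) (g : 'rV[int]_n) (x : cantor_shift n) :
    cantor_shift n :=
  fun h => x (h + g).

Definition free_part (n : nat) : set (cantor_shift n) :=
  [set x | forall g : 'rV[int]_n, g != 0 -> shift_act g x <> x].

(* [set_type A] carries the subspace topology induced by its inclusion
   [set_val]. *)
Definition free_shift (n : nat) : topologicalType := set_type (@free_part n).

Definition std_gen (n : nat) (i : 'I_n) : 'rV[int]_n := delta_mx 0 i.

Definition schreier_arc (n : nat) (x y : free_shift n) : Prop :=
  exists i : 'I_n, set_val y = shift_act (std_gen i) (set_val x).

Definition P5 : topologicalType := discrete_topology 'Z_5.

Definition P5_arc (i j : 'Z_5) : Prop := j - i = 1 \/ j - i = 2.

(* Main.v *)
Require Import Defs.
From mathcomp Require Import all_boot all_order all_algebra.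
From mathcomp Require Import all_classical all_reals all_analysis.
From mathcomp Require Import zify ring.

(** Give every vertex a height in Z/10 that grows by 2, 3 or 4 along each arc;
half of it, rounded down, is a vertex of P_5 and grows by 1 or 2
([halve_arc]).  On one orbit, a copy of Z^n, such heights are easy: 3 times the
sum of the coordinates, counted from a base point.  A Borel choice of a single
base point per orbit is impossible, so the orbit is cut into finite pieces,
each with its own base point.  Two pieces disagree by a constant in Z/10, with
a representative in {0, ..., 9}; since a step may exceed or fall short of 3 by
1, a piece can absorb this disagreement within distance 9 of the other piece,
reducing the correction by 1 with each step away from it.  Only one correction
may be active at a time: three mutually adjacent pieces could make the
corrections wind around the circle Z/10.  So the pieces have to form a toast:
two of them are either far apart or one lies deep inside the other.

The toast comes from centres.  For every scale r_k = 10^(k+1) there is a Borel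
set that meets each box of radius 10 r_k but whose points are more than 10 r_k
apart ([markers_separated], [markers_cover]).  Its translates by r_k v, where v
has entries between -10 and 10, have points equally far apart and together
come within r_k of every point.  The number of translates is the same at all
scales, so by the pigeonhole principle some v serves a given point at
infinitely many scales; as r_k tends to infinity, such a v serves, up to a
factor 2, every point of the same orbit.  Choosing the first such v for each
orbit gives a single Borel set of centres at each scale, with points more than
10 r_k apart, such that every point is within 2 r_k of a centre of some scale
k ([centre_separated], [centre_covering]).

The piece of a centre of scale k is the ball of radius 2 r_k, enlarged by
everything that touches it through the pieces of smaller scales.  As distances
between centres dwarf the sizes of smaller pieces, these chains stay bounded
([merged_dist]), so pieces of the same scale are far apart ([piece_inj]), and a
smaller piece that comes near a larger one is swallowed together with a margin
([piece_absorbs]).  A point takes its base point from the smallest piece that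
contains it, and [height_step] is the resulting bound on the growth of the
height.  All these definitions quantify over countable sets only and commute
with the shift, so the heights are Borel and depend on the point alone. *)

Set Implicit Arguments.
Unset Strict Implicit.
Unset Printing Implicit Defensive.

Import Order.TTheory GRing.Theory Num.Theory.
Local Open Scope ring_scope.

(** * The sup distance on Z^d *)

Section SupDistance.
Variable d : nat.
Implicit Types a b c : 'rV[int]_d.

Definition sup_norm a : nat := \max_(i < d) `|a ord0 i|%N.

Lemma sup_norm_leP a k :
  reflect (forall i, (`|a ord0 i| <= k)%N) (sup_norm a <= k)%N.
Proof.
apply: (iffP idP) => [ak i|ak]; last by apply/bigmax_leqP.
by apply: leq_trans ak; exact: (leq_bigmax i).
Qed.

Lemma sup_norm_coord a i : (`|a ord0 i| <= sup_norm a)%N.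
Proof. exact/sup_norm_leP. Qed.

Lemma sup_normN a : sup_norm (- a) = sup_norm a.
Proof. by apply: eq_bigr => i _; rewrite mxE abszN. Qed.

Lemma sup_normD a b : (sup_norm (a + b) <= sup_norm a + sup_norm b)%N.
Proof.
apply/sup_norm_leP => i; rewrite mxE.
have := sup_norm_coord a i; have := sup_norm_coord b i.
by move: (a ord0 i) (b ord0 i) => u v; lia.
Qed.

Lemma sup_norm_eq0 a : sup_norm a = 0%N -> a = 0.
Proof.
move=> a0; apply/matrixP => i j; rewrite ord1 mxE.
by have := sup_norm_coord a j; rewrite a0; move: (a ord0 j) => u; lia.
Qed.

Definition dist a b : nat := sup_norm (a - b).

Lemma dist_self a : dist a a = 0%N.
Proof.
by apply/eqP; rewrite -leqn0 /dist subrr; apply/sup_norm_leP => i; rewrite mxE.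
Qed.

Lemma distC a b : dist a b = dist b a.
Proof. by rewrite /dist -opprB sup_normN. Qed.

Lemma dist_triangle b a c : (dist a c <= dist a b + dist b c)%N.
Proof. by rewrite /dist -[a - c](subrKA b) sup_normD. Qed.

Lemma dist_gt0 a b : a <> b -> (0 < dist a b)%N.
Proof.
by move=> ab; rewrite lt0n; apply/eqP => /sup_norm_eq0/eqP; rewrite subr_eq0 => /eqP.
Qed.

Lemma distDr a b c : dist (a + c) (b + c) = dist a b.
Proof. by rewrite /dist opprD addrACA subrr addr0. Qed.

End SupDistance.

(** * Pieces *)

Definition rad (n : nat) : nat := (10 ^ n.+1)%N.

Lemma radS n : rad n.+1 = (10 * rad n)%N.
Proof. exact: expnS. Qed.

Lemma rad_ge10 n : (10 <= rad n)%N.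
Proof. by elim: n => // n; rewrite radS; lia. Qed.

Lemma rad_gt n : (n < rad n)%N.
Proof. by elim: n => // n; rewrite radS; lia. Qed.

Section Pieces.
Variable d : nat.
Local Notation G := 'rV[int]_d.
Implicit Types (M : nat -> G -> Prop) (R : G -> G -> Prop) (a b c m x y : G).

Definition core R (r : nat) m a : Prop :=
  exists b, (dist b m <= 2 * r)%N /\ R b a.

Definition collar R (r : nat) m a : Prop :=
  exists b c, [/\ core R r m b, (dist b c <= 10)%N & R c a].

(** The relation whose classes are the clusters formed by the pieces of scale
below [n].  For [separated] centres it is an equivalence, because the collars of
distinct centres are then disjoint ([collar_inj]); spelling it out in this way, instead of taking a
transitive closure, makes its Borel complexity and its bounds evident. *)
Fixpoint merged M (n : nat) a b : Prop :=
  if n is n'.+1 then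
    merged M n' a b \/
    exists m, [/\ M n' m, collar (merged M n') (rad n') m a
                & collar (merged M n') (rad n') m b]
  else a = b.

(** A union of clusters of smaller scales.  The next scale merges it with a
margin of width 10 around it, and that margin keeps it away from the boundary of
the larger pieces containing it.  The width is 9, the reach of a correction, plus
1 for an arc that crosses the boundary. *)
Definition piece M n m a : Prop := M n m /\ core (merged M n) (rad n) m a.

Definition separated M : Prop := forall n m m',
  M n m -> M n m' -> (dist m m' <= 10 * rad n)%N -> m = m'.

Definition covering M : Prop := forall a,
  exists n m, M n m /\ (dist a m <= 2 * rad n)%N.

Lemma core_dist R r m a : (forall b c, R b c -> (dist b c <= r)%N) ->
  core R r m a -> (dist a m <= 3 * r)%N.
Proof.
move=> Rr [b [bm /Rr ba]].
by have := dist_triangle b a m; rewrite (distC a b); lia.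
Qed.

Lemma collar_dist R r m a : (forall b c, R b c -> (dist b c <= r)%N) ->
  collar R r m a -> (dist a m <= 4 * r + 10)%N.
Proof.
move=> Rr [b [c [/(core_dist Rr) bm bc /Rr ca]]].
have := dist_triangle c a m; have := dist_triangle b c m.
by rewrite (distC a c) (distC c b); lia.
Qed.

(** A collar reaches at most 2r + r + 10 + r <= 5r from its centre, hence a class
of the next scale has diameter at most 10r. *)
Lemma merged_dist M n a b : merged M n a b -> (dist a b <= rad n)%N.
Proof.
elim: n a b => [a b ->|n IH a b /=]; first by rewrite dist_self.
have r10 := rad_ge10 n; rewrite radS => -[/IH|[m [_ am bm]]]; first by lia.
have := collar_dist IH am; have := collar_dist IH bm.
by have := dist_triangle m a b; rewrite (distC m b); lia.
Qed.

Lemma merged_refl M n a : merged M n a a.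
Proof. by elim: n => //= n IH; left. Qed.

Lemma merged_sym M n a b : merged M n a b -> merged M n b a.
Proof.
elim: n a b => [//|n IH] a b /= [/IH ba|[m [Mm am bm]]]; first by left.
by right; exists m.
Qed.

Lemma merged_le M j n a b : (j <= n)%N -> merged M j a b -> merged M n a b.
Proof.
by move=> /subnK <-; elim: (n - j)%N => // k IH /IH; rewrite addSn; left.
Qed.

Lemma collar_inj M n m m' a : separated M -> M n m -> M n m' ->
  collar (merged M n) (rad n) m a -> collar (merged M n) (rad n) m' a -> m = m'.
Proof.
move=> sM Mm Mm' /(collar_dist (@merged_dist M n)) am
  /(collar_dist (@merged_dist M n)) am'.
apply: (sM n) => //; have := dist_triangle a m m'; have := rad_ge10 n.
by rewrite (distC m a); lia.
Qed.

Lemma merged_trans M n a b c : separated M ->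
  merged M n a b -> merged M n b c -> merged M n a c.
Proof.
move=> sM; elim: n a b c => [a b c -> //|n IH] a b c /=.
have col m x y : merged M n x y -> collar (merged M n) (rad n) m x ->
    collar (merged M n) (rad n) m y.
  by move=> xy [u [v [mu uv vx]]]; exists u, v; split=> //; exact: IH xy.
move=> [ab|[m [Mm am bm]]] [bc|[m' [Mm' bm' cm']]].
- by left; exact: IH bc.
- by right; exists m'; split=> //; apply: col bm'; exact: merged_sym.
- by right; exists m; split=> //; apply: col bm.
- rewrite -(collar_inj sM Mm Mm' bm bm') in cm'.
  by right; exists m.
Qed.

Lemma piece_inj M n m m' x y : separated M ->
  piece M n m x -> piece M n m' y -> (dist x y <= 10)%N -> m = m'.
Proof.
move=> sM [Mm /(core_dist (@merged_dist M n)) xm].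
move=> [Mm' /(core_dist (@merged_dist M n)) ym'] xy.
apply: (sM n) => //; have := rad_ge10 n.
have := dist_triangle x m m'; have := dist_triangle y x m'.
by rewrite (distC m x); lia.
Qed.

(** All points within 10 of the small piece lie in one class of
[merged M j.+1], and the large piece is a union of such classes. *)
Lemma piece_absorbs M j n m m' x x' y y' : separated M -> (j < n)%N ->
  piece M j m' x' -> (dist x' x <= 10)%N -> piece M n m x ->
  piece M j m' y' -> (dist y' y <= 10)%N -> piece M n m y.
Proof.
move=> sM jn [Mm' x'm'] xx' [Mm [b [bm bx]]] [_ y'm'] yy'; split=> //.
exists b; split=> //; apply: merged_trans bx _ => //.
apply: (merged_le jn); right; exists m'; split=> //.
  by exists x', x; split=> //; exact: merged_refl.
by exists y', y; split=> //; exact: merged_refl.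
Qed.

(** * Heights *)

Definition phase a : 'Z_10 := (3 * \sum_(i < d) a 0 i)%:~R.

Lemma phaseD a b : phase (a + b) = phase a + phase b.
Proof.
rewrite /phase -intrD -mulrDr -big_split; congr ((3 * _)%:~R).
by apply: eq_bigr => i _; rewrite mxE.
Qed.

Lemma phaseB a b : phase (a - b) = phase a - phase b.
Proof. by apply: (addIr (phase b)); rewrite -phaseD !subrK. Qed.

Lemma phase_std_gen (i : 'I_d) : phase (std_gen i) = 3%:R.
Proof.
rewrite /phase (bigD1 i) //= big1 => [|j ji]; rewrite mxE ?eqxx ?(negbTE ji) //.
Qed.

(** What is to be added to the height based at [m] to get the one based at [m'],
as a number from 0 to 9. *)
Definition offset m m' : nat := phase (m - m').

Definition first_piece M n m x : Prop :=
  piece M n m x /\ forall j m', (j < n)%N -> ~ piece M j m' x.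

(** The correction [t] that a point [x] of the piece of [m] receives from the smaller
pieces: the largest value of the offset minus the distance, or 0 if that is
negative.  As a maximum of 1-Lipschitz functions it needs no choice of a nearest
piece to be 1-Lipschitz. *)
Definition pull M n m x (t : nat) : Prop :=
  (t = 0%N \/ exists j m' b,
     [/\ (j < n)%N, piece M j m' b & (t + dist x b <= offset m m')%N]) /\
  forall j m' b, (j < n)%N -> piece M j m' b -> (offset m m' <= t + dist x b)%N.

Definition height M x (v : 'Z_10) : Prop :=
  exists n m t, [/\ first_piece M n m x, pull M n m x t
                  & v = phase (x - m) + t%:R].

Lemma offset_le9 m m' : (offset m m' <= 9)%N.
Proof. by rewrite -ltnS; exact: (ltn_ord (phase (m - m'))). Qed.

Lemma offsetE m m' : (offset m m')%:R = phase (m - m').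
Proof. exact: natr_Zp. Qed.

Lemma height_exists M x : covering M -> exists v, height M x v.
Proof.
move=> /(_ x)[n0 [m0 [Mm0 xm0]]].
have /asboolP ex0 : `[< exists m, piece M n0 m x >].
  by apply/asboolP; exists m0; split=> //; exists x; split=> //; exact: merged_refl.
have exn : exists n, `[< exists m, piece M n m x >].
  by exists n0; exact/asboolP.
case: (ex_minnP exn) => n /asboolP[m nmx] nmin.
pose reach t := `[< t = 0%N \/ exists j m' b,
  [/\ (j < n)%N, piece M j m' b & (t + dist x b <= offset m m')%N] >].
have ext : exists t, reach t by exists 0%N; apply/asboolP; left.
have leT t : reach t -> (t <= 9)%N.
  move=> /asboolP[->//|[j [m' [b [_ _ tb]]]]].
  by have := offset_le9 m m'; lia.
case: (ex_maxnP ext leT) => t /asboolP reacht tmax.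
exists (phase (x - m) + t%:R), n, m, t; split=> //.
  split=> // j m' jn jm'x; have := nmin j; rewrite leqNgt jn => /(_ _)/negP; apply=> //.
  by apply/asboolP; exists m'.
split=> // j m' b jn jm'b; rewrite leqNgt; apply/negP => lt.
have := tmax (offset m m' - dist x b)%N; rewrite leqNgt => /(_ _)/negP; apply; last by lia.
by apply/asboolP; right; exists j, m', b; split=> //; lia.
Qed.

Lemma pull_lipschitz M n m x y t u :
  pull M n m x t -> pull M n m y u -> (t <= u + dist x y)%N.
Proof.
move=> [[->//|[j [m' [b [jn jm'b tb]]]]] _] [_ /(_ j m' b jn jm'b)].
by have := dist_triangle x y b; rewrite (distC y x); lia.
Qed.

(** Across the boundary of the piece of [m'] the correction at [x] compensates the
change of base point up to 1.  No other piece interferes: pieces of the same scale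
as that of [m'] are too far away, and one of another scale below [n] that comes
within 9 of [y] would be nested with the piece of [m'], so that [x] would lie in
a piece of scale below [n].  For the same reason [y] gets no correction. *)
Lemma height_across M j n m m' x y t u : separated M -> (dist x y <= 1)%N ->
  (j < n)%N -> first_piece M n m x -> pull M n m x t ->
  first_piece M j m' y -> pull M j m' y u ->
  u = 0%N /\ (t <= offset m m' <= t + 1)%N.
Proof.
move=> sM xy jn [nmx minx] [tx maxx] [jm'y miny] [uy maxy].
have near i m'' b : piece M i m'' b -> (dist y b <= 9)%N -> (i < n)%N ->
    i = j /\ m'' = m'.
  move=> im''b yb iltn.
  have xb : (dist x b <= 10)%N by have := dist_triangle y x b; lia.
  case: (ltngtP i j) => [ij|ji|ij].
  - case: (minx j m' jn).
    by apply: (piece_absorbs sM ij im''b _ jm'y im''b); rewrite distC; lia.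
  - case: (minx i m'' iltn).
    apply: (piece_absorbs sM ji jm'y _ im''b jm'y); first by lia.
    by rewrite distC; lia.
  - subst i; split=> //; apply: (piece_inj sM im''b jm'y).
    by rewrite distC; lia.
split.
  case: uy => // -[i [m'' [b [ij im''b ub]]]].
  have yb : (dist y b <= 9)%N by have := offset_le9 m' m''; lia.
  by have [ij' _] := near i m'' b im''b yb (ltn_trans ij jn); lia.
have := maxx j m' y jn jm'y.
case: tx => [->|[i [m'' [b [iltn im''b tb]]]]]; first by lia.
case: (posnP t) => [->|t0]; first by lia.
have xb : x <> b by move=> xb; apply: (minx i m''); rewrite ?xb.
have xb0 := dist_gt0 xb; have o9 := offset_le9 m m''.
have yb : (dist y b <= 9)%N.
  by have := dist_triangle x y b; rewrite (distC y x); lia.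
by have [_ m''m'] := near i m'' b im''b yb iltn; rewrite m''m' in tb; lia.
Qed.

(** Inside a piece the height based at its centre grows by 3 and the correction
changes by at most 1; across a boundary [height_across] applies. *)
Lemma height_step M x y v w (i : 'I_d) : separated M ->
  y = x + std_gen i -> height M x v -> height M y w ->
  exists2 s, (2 <= s <= 4)%N & w = v + s%:R.
Proof.
move=> sM yx [n [m [t [xf xp ->]]]] [j [m' [u [yf yp ->]]]].
have xy : (dist x y <= 1)%N.
  rewrite /dist yx opprD addNKr sup_normN; apply/sup_norm_leP => k.
  by rewrite mxE; case: eqP => //; case: eqP.
have yx1 : (dist y x <= 1)%N by rewrite distC.
have phy : phase y = phase x + 3%:R by rewrite yx phaseD phase_std_gen.
case: (ltngtP j n) => [jn|nj|jn].
- have [-> tk] := height_across sM xy jn xf xp yf yp.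
  exists (3 + (offset m m' - t))%N; first by lia.
  rewrite natrD natrB; last by lia.
  by rewrite offsetE !phaseB phy; ring.
- have [-> tk] := height_across sM yx1 nj yf yp xf xp.
  exists (3 - (offset m' m - u))%N; first by lia.
  rewrite natrB; last by lia.
  rewrite natrB; last by lia.
  by rewrite offsetE !phaseB phy; ring.
- subst j; have mm' : m = m'.
    by apply: (piece_inj sM xf.1 yf.1); lia.
  subst m'; have tu := pull_lipschitz xp yp; have ut := pull_lipschitz yp xp.
  exists (3 + u - t)%N; first by lia.
  rewrite natrB; last by lia.
  by rewrite natrD !phaseB phy; ring.
Qed.

End Pieces.

(** * Equivariance, and passage to Z/5 *)

Definition halve (v : 'Z_10) : 'Z_5 := (val v)./2%:R.

Lemma halve_arc v s : (2 <= s <= 4)%N -> P5_arc (halve v) (halve (v + s%:R)).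
Proof.
have chk : [forall u : 'Z_10, [forall k : 'I_3,
    (halve (u + (2 + k)%:R) - halve u == 1) || (halve (u + (2 + k)%:R) - halve u == 2)]].
  (* a finite check over the ten heights and the three increments *)
  by apply/'forall_forallP => -[[|[|[|[|[|[|[|[|[|[|//]]]]]]]]]] iu] [[|[|[|//]]] ik].
move=> /andP[s2 s4]; have sk : (s - 2 < 3)%N by lia.
have /forallP/(_ v)/forallP/(_ (Ordinal sk)) := chk.
by rewrite /= subnKC // => /orP[/eqP|/eqP]; [left|right].
Qed.

Section Translation.
Variable d : nat.
Local Notation G := 'rV[int]_d.
Implicit Types (M : nat -> G -> Prop) (a b c m x y : G).

Definition translate M (g : G) : nat -> G -> Prop := fun n a => M n (a + g).

Lemma ex_translate (g : G) (P : G -> Prop) :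
  (exists b, P b) -> exists b, P (b + g).
Proof. by move=> [b Pb]; exists (b - g); rewrite subrK. Qed.

Lemma core_translate (R R' : G -> G -> Prop) g r m a :
  (forall a b, R' a b <-> R (a + g) (b + g)) ->
  core R' r m a <-> core R r (m + g) (a + g).
Proof.
move=> RR'; split=> [[b [bm /RR' ba]]|/(ex_translate g)[b [bm /RR' ba]]].
  by exists (b + g); rewrite distDr.
by exists b; rewrite -(distDr b m g).
Qed.

Lemma collar_translate (R R' : G -> G -> Prop) g r m a :
  (forall a b, R' a b <-> R (a + g) (b + g)) ->
  collar R' r m a <-> collar R r (m + g) (a + g).
Proof.
move=> RR'; split=> [[b]|/(ex_translate g)[b]].
  move=> [c [/(core_translate r m b RR') bm bc /RR' ca]].
  by exists (b + g), (c + g); rewrite distDr.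
move=> /(ex_translate g)[c [/(core_translate r m b RR') bm bc /RR' ca]].
by exists b, c; rewrite -(distDr b c g).
Qed.

Lemma merged_translate M g n a b :
  merged (translate M g) n a b <-> merged M n (a + g) (b + g).
Proof.
elim: n a b => [a b|n IH a b] /=; first by split=> [->//|/addIr].
have E := collar_translate (rad n) _ _ IH.
split=> -[/IH ?|]; [by left| |by left|].
- by move=> [m [Mm /E am /E bm]]; right; exists (m + g).
- by move=> /(ex_translate g)[m [Mm /E am /E bm]]; right; exists m.
Qed.

Lemma piece_translate M g n m a :
  piece (translate M g) n m a <-> piece M n (m + g) (a + g).
Proof.
have E := core_translate (rad n) m a (merged_translate M g n).
by split=> -[? /E ?].
Qed.

Lemma height_translate M g x v :
  height (translate M g) x v -> height M (x + g) v.
Proof.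
have E := piece_translate M g; have oE m m' : offset (m + g) (m' + g) = offset m m'.
  by rewrite /offset opprD addrACA subrr addr0.
move=> [n [m [t [[/E nmx minx] [tx maxx] ->]]]]; exists n, (m + g), t; split.
- split=> // j m' jn; rewrite -(subrK g m') => /E; exact: minx.
- split.
    case: tx => [->|[j [m' [b [jn /E jm'b tb]]]]]; [by left|right].
    by exists j, (m' + g), (b + g); rewrite distDr oE.
  move=> j m' b; rewrite -(subrK g m') -(subrK g b) => jn /E jm'b.
  by rewrite distDr oE; exact: maxx jm'b.
- by rewrite opprD addrACA subrr addr0.
Qed.
End Translation.

(** * Borel predicates *)

Local Open Scope classical_set_scope.

Section BorelPredicates.
Variable X : topologicalType.

Lemma borel_open (A : set X) : open A -> borel A.
Proof. by rewrite /borel => oA; apply: sub_sigma_algebra. Qed.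

Lemma borel_not (P : X -> Prop) : @borel X P -> @borel X (fun x => ~ P x).
Proof.
move=> bP; rewrite (_ : (fun x => _) = [set: X] `\` P); last by rewrite setTD.
exact (sigma_algebraCD bP).
Qed.

Lemma borel_const (P : Prop) : @borel X (fun=> P).
Proof.
apply: borel_open; have [p|np] := EM P.
  by rewrite (_ : (fun=> P) = setT) ?predeqE //; exact: openT.
by rewrite (_ : (fun=> P) = set0) ?predeqE //; exact: open0.
Qed.

Lemma borel_exists (T : countType) (P : T -> X -> Prop) :
  (forall t, @borel X (P t)) -> @borel X (fun x => exists t, P t x).
Proof.
move=> bP.
pose A k : set X := if unpickle k is Some t then P t else fun=> False.
rewrite (_ : (fun x => _) = \bigcup_k A k).
  apply: (@sigma_algebra_bigcup _ setT open) => k; rewrite /A; case: unpickle => // ; exact: borel_const.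
apply/seteqP; split=> x /= [].
  by move=> t Pt; exists (pickle t) => //; rewrite /A pickleK.
by move=> k _; rewrite /A; case: unpickle => // t; exists t.
Qed.

Lemma borel_forall (T : countType) (P : T -> X -> Prop) :
  (forall t, @borel X (P t)) -> @borel X (fun x => forall t, P t x).
Proof.
move=> bP; rewrite (_ : (fun x => _) = (fun x => ~ exists t, ~ P t x)).
  by apply: borel_not; apply: borel_exists => t; exact: borel_not.
by apply/funext => x; rewrite -forallNE; apply/propext; split=> H t; [apply|apply: contrapT].
Qed.

Lemma borel_or (P Q : X -> Prop) :
  @borel X P -> @borel X Q -> @borel X (fun x => P x \/ Q x).
Proof.
move=> bP bQ; rewrite (_ : (fun x => _) = fun x => exists b : bool, if b then P x else Q x).
  by apply: borel_exists => -[].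
apply/funext => x; apply/propext; split=> [[?|?]|[[] ?]].
- by exists true.
- by exists false.
- by left.
- by right.
Qed.

Lemma borel_and (P Q : X -> Prop) :
  @borel X P -> @borel X Q -> @borel X (fun x => P x /\ Q x).
Proof.
move=> bP bQ; rewrite (_ : (fun x => _) = fun x => forall b : bool, if b then P x else Q x).
  by apply: borel_forall => -[].
apply/funext => x; apply/propext; split=> [[? ?] []//|H].
by split; [exact: (H true)|exact: (H false)].
Qed.

Lemma borel_and3 (P Q R : X -> Prop) : @borel X P -> @borel X Q ->
  @borel X R -> @borel X (fun x => [/\ P x, Q x & R x]).
Proof.
move=> bP bQ bR; rewrite (_ : (fun x => _) = fun x => P x /\ Q x /\ R x).
  by apply: borel_and => //; exact: borel_and.
by apply/funext => x; apply/propext; split=> [[]|[? []]].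
Qed.

Lemma borel_implies (P Q : X -> Prop) :
  @borel X P -> @borel X Q -> @borel X (fun x => P x -> Q x).
Proof.
move=> bP bQ; rewrite (_ : (fun x => _) = fun x => ~ P x \/ Q x).
  by apply: borel_or => //; exact: borel_not.
by apply/funext => x; rewrite -implyE.
Qed.

End BorelPredicates.

Lemma borel_preimage (X Y : topologicalType) (f : X -> Y) (B : set Y) :
  continuous f -> borel B -> borel (f @^-1` B).
Proof.
move=> /continuousP fo; rewrite /borel => bB.
suff : <<s open >> `<=` [set A : set Y | borel (f @^-1` A)] by move/(_ _ bB).
apply: smallest_sub; last by move=> A /fo; exact: borel_open.
split=> [|A bA|A bA] /=.
- by rewrite preimage_set0; exact: borel_const.
- by rewrite setTD preimage_setC; exact: borel_not.
- by rewrite preimage_bigcup; exact: (sigma_algebra_bigcup bA).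
Qed.

Ltac borel_connectives :=
  repeat match goal with
  | |- @borel _ (fun x => _ -> _) => apply: borel_implies
  | |- @borel _ (fun x => forall t, _) => apply: borel_forall => ?
  | |- @borel _ (fun x => exists t, _) => apply: borel_exists => ?
  | |- @borel _ (fun x => _ \/ _) => apply: borel_or
  | |- @borel _ (fun x => _ /\ _) => apply: borel_and
  | |- @borel _ (fun x => [/\ _, _ & _]) => apply: borel_and3
  | |- @borel _ (fun x => ~ _) => apply: borel_not
  | _ => assumption
  | _ => apply: borel_const
  end.

Section BorelHeight.
Variables (X : topologicalType) (d : nat).
Local Notation G := 'rV[int]_d.
Variable M : X -> nat -> G -> Prop.
Hypothesis borelM : forall n a, @borel X (fun x => M x n a).

Lemma borel_core (R : X -> G -> G -> Prop) r m a :
  (forall b c, @borel X (fun x => R x b c)) ->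
  @borel X (fun x => core (R x) r m a).
Proof. by move=> bR; rewrite /core; borel_connectives. Qed.

Lemma borel_collar (R : X -> G -> G -> Prop) r m a :
  (forall b c, @borel X (fun x => R x b c)) ->
  @borel X (fun x => collar (R x) r m a).
Proof. by move=> bR; rewrite /collar; borel_connectives; first exact: borel_core. Qed.

Lemma borel_merged n a b : @borel X (fun x => merged (M x) n a b).
Proof.
elim: n a b => [|n IH] a b /=; borel_connectives; rewrite //; exact: borel_collar.
Qed.

Lemma borel_piece n m a : @borel X (fun x => piece (M x) n m a).
Proof.
rewrite /piece; borel_connectives => //; apply: borel_core => b c; exact: borel_merged.
Qed.

Lemma borel_height a v : @borel X (fun x => height (M x) a v).
Proof.
by rewrite /height /first_piece /pull; borel_connectives; exact: borel_piece.
Qed.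
End BorelHeight.

(** * The shift action *)

Section ShiftAction.
Variable d : nat.
Local Notation G := 'rV[int]_d.
Local Notation X := (cantor_shift d).
Implicit Types (g h a b v w : G) (x : X).

Lemma shift_actD g h x : shift_act g (shift_act h x) = shift_act (g + h) x.
Proof. by apply/funext => a; rewrite /shift_act addrA. Qed.

Lemma shift_act0 x : shift_act 0 x = x.
Proof. by apply/funext => a; rewrite /shift_act addr0. Qed.

Lemma free_part_act g x : free_part x -> free_part (shift_act g x).
Proof.
move=> fx h h0 hgx; apply: (fx h h0).
have -> : shift_act h x = shift_act (- g) (shift_act h (shift_act g x)).
  by rewrite !shift_actD addrAC addNr add0r.
by rewrite hgx shift_actD addNr shift_act0.
Qed.

Lemma shift_act_continuous g : continuous (shift_act g : X -> X).
Proof.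
move=> x; apply/cvg_sup => a.
have : continuous (shift_act g : X -> initial_topology (fun y : G -> bool => y a)).
  by apply: continuous_comp_initial; exact: (@proj_continuous _ (fun=> bool) (a + g)).
exact.
Qed.

Lemma borel_coord a (c : bool) : @borel X (fun x => x a = c).
Proof.
apply: (@borel_preimage X bool (fun x => x a) [set c]).
  exact: (@proj_continuous _ (fun=> bool) a).
by apply: borel_open; exact: discrete_open.
Qed.

Lemma borel_shift (P : X -> Prop) g :
  borel P -> @borel X (fun x => P (shift_act g x)).
Proof. by move=> bP; apply: borel_preimage bP; exact: shift_act_continuous. Qed.

Definition ball (r : nat) : seq G :=
  [seq \row_i ((f i : nat)%:Z - r%:Z) | f : {ffun 'I_d -> 'I_(2 * r).+1}].

Lemma mem_ball r g : (sup_norm g <= r)%N -> g \in ball r.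
Proof.
move=> /sup_norm_leP gr; apply/fintype.imageP.
have lt i : (absz (g ord0 i + r%:Z)%R < (2 * r).+1)%N.
  by have := gr i; move: (g ord0 i) => u; lia.
exists [ffun i => Ordinal (lt i)] => //; apply/rowP => i; rewrite mxE ffunE /=.
by have := gr i; move: (g 0 i) => u; lia.
Qed.

(** * Separated Borel sets of markers *)

(** The pattern [s] occurs at [x] but at no other point of its orbit within
distance [r].  The countably many sets [isolated r s] cover the free part
([isolated_exists]), and each is [r]-separated. *)
Definition isolated r (s : seq (G * bool)) x : Prop :=
  (forall p, p \in s -> x p.1 = p.2) /\
  forall g, g <> 0 -> (sup_norm g <= r)%N ->
    ~ forall p, p \in s -> shift_act g x p.1 = p.2.

Lemma isolated_exists r x : free_part x -> exists s, isolated r s x.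
Proof.
move=> fx; have /choice[h hP] : forall g, exists a, g <> 0 -> x (a + g) <> x a.
  move=> g; have [->|g0] := EM (g = 0); first by exists 0.
  apply: contrapT => nex; apply: (fx g); first exact/eqP.
  by apply/funext => a; apply: contrapT => ne; apply: nex; exists a.
exists [seq (h g, x (h g)) | g <- ball r]; split=> [p /mapP[g _ ->]//|g g0 gr].
by move=> /(_ _ (map_f _ (mem_ball gr))); exact: hP.
Qed.

Definition pattern (k : nat) : seq (G * bool) := odflt [::] (unpickle k).

(** The markers are chosen greedily, one pattern after the other, which makes
them a maximal separated set. *)
Fixpoint greedy r k x : Prop :=
  if k is k'.+1 then
    greedy r k' x \/
    (isolated r (pattern k') x /\
     forall g, (sup_norm g <= r)%N -> ~ greedy r k' (shift_act g x))
  else False.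

Definition markers r x : Prop := exists k, greedy r k x.

Lemma greedy_le r j k x : (j <= k)%N -> greedy r j x -> greedy r k x.
Proof.
by move=> /subnK <-; elim: (k - j)%N => // i IH /IH; rewrite addSn; left.
Qed.

Lemma greedy_separated r k g x : (sup_norm g <= r)%N ->
  greedy r k x -> greedy r k (shift_act g x) -> g = 0.
Proof.
move=> gr; elim: k => //= k IH [xk|[xs xk]] [gxk|[gxs gxk]].
- exact: IH.
- case: (gxk (- g)); first by rewrite sup_normN.
  by rewrite shift_actD addNr shift_act0.
- by case: (xk g gr).
- by apply: contrapT => g0; exact: (xs.2 g g0 gr gxs.1).
Qed.

Lemma markers_separated r g x : (sup_norm g <= r)%N ->
  markers r x -> markers r (shift_act g x) -> g = 0.
Proof.
move=> gr [j xj] [k xk]; apply: (greedy_separated gr (k := maxn j k) (x := x)).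
  by apply: greedy_le xj; rewrite leq_maxl.
by apply: greedy_le xk; rewrite leq_maxr.
Qed.

Lemma markers_cover r x : free_part x ->
  exists g, (sup_norm g <= r)%N /\ markers r (shift_act g x).
Proof.
move=> /(isolated_exists r)[s xs].
have [[g [gr gx]]|no] := EM (exists g, (sup_norm g <= r)%N /\
  greedy r (pickle s) (shift_act g x)).
  by exists g; split=> //; exists (pickle s).
exists 0; rewrite shift_act0; split.
  by rewrite -[0](subrr (0 : G)); have := dist_self (0 : G); rewrite /dist => ->.
exists (pickle s).+1; right; rewrite /pattern pickleK; split=> // g gr gx.
by apply: no; exists g.
Qed.

Lemma borel_isolated r s : @borel X (isolated r s).
Proof.
rewrite /isolated; borel_connectives; first exact: borel_coord.
exact: (@borel_shift (fun x => x _ = _) _ (borel_coord _ _)).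
Qed.

Lemma borel_markers r : @borel X (markers r).
Proof.
rewrite /markers; apply: borel_exists; elim=> [|k IH] /=; first exact: borel_const.
apply: borel_or => //; apply: borel_and; first exact: borel_isolated.
by borel_connectives; exact: borel_shift.
Qed.

(** * Centres *)

Definition moved_markers n v x : Prop :=
  markers (10 * rad n) (shift_act (v *+ rad n) x).

(** A marker at [g] is moved next to 0 by rounding the coordinates of [g] down to
multiples of [rad n]. *)
Lemma moved_markers_cover n x : free_part x -> exists v w,
  [/\ (sup_norm v <= 10)%N, (sup_norm w <= rad n)%N
    & moved_markers n v (shift_act w x)].
Proof.
move=> /(markers_cover (10 * rad n))[g [gr gx]]; have r10 := rad_ge10 n.
pose v : G := \row_i (g ord0 i %/ (rad n)%:Z)%Z.
have vE : v *+ rad n + (g - v *+ rad n) = g by rewrite addrC subrK.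
exists v, (g - v *+ rad n); split; last by rewrite /moved_markers shift_actD vE.
- apply/sup_norm_leP => i; rewrite mxE; move/sup_norm_leP/(_ i): gr.
  by move: (g ord0 i) (rad n) r10 => u r r10; nia.
- apply/sup_norm_leP => i; rewrite !mxE mulmxnE mxE.
  by move: (g ord0 i) (rad n) r10 => u r r10; lia.
Qed.

(** The base point [g] is existentially quantified in order to make the notion
invariant under the action. *)
Definition recurrent v x : Prop := exists g, forall k, exists n w,
  [/\ (k <= n)%N, (sup_norm w <= rad n)%N & moved_markers n v (shift_act (w + g) x)].

Lemma recurrent_act v g x : recurrent v x -> recurrent v (shift_act g x).
Proof.
move=> [h hP]; exists (h - g) => k; have [n [w [kn wn wx]]] := hP k.
by exists n, w; split=> //; rewrite shift_actD -addrA subrK.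
Qed.

(** Pigeonhole over the finitely many [v]: otherwise each [v] fails from some scale
on, and no [v] is left at the largest of these scales. *)
Lemma recurrent_exists x : free_part x ->
  exists v, (sup_norm v <= 10)%N /\ recurrent v x.
Proof.
move=> fx; apply: contrapT => no.
have bound v : exists k, (sup_norm v <= 10)%N -> forall n w,
    (k <= n)%N -> (sup_norm w <= rad n)%N -> ~ moved_markers n v (shift_act w x).
  apply: contrapT => nk; apply: no; exists v; split.
    by apply: contrapT => v10; apply: nk; exists 0%N.
  exists 0 => k; apply: contrapT => nx; apply: nk; exists k => _ n w kn wn wx.
  by apply: nx; exists n, w; rewrite addr0.
have /choice[K KP] := bound.
have [v [w [v10 wn]]] := moved_markers_cover (\max_(u <- ball 10) K u) fx.
apply: (KP v v10 _ _ _ wn).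
by apply: leq_bigmax_seq => //; exact: mem_ball.
Qed.

Definition chosen v x : Prop :=
  [/\ (sup_norm v <= 10)%N, recurrent v x &
      forall u, (pickle u < pickle v)%N -> (sup_norm u <= 10)%N -> ~ recurrent u x].

Definition centre x n a : Prop :=
  exists v, chosen v (shift_act a x) /\ moved_markers n v (shift_act a x).

Lemma chosen_act v g x : chosen v x -> chosen v (shift_act g x).
Proof.
move=> [v10 vx vmin]; split=> //; first exact: recurrent_act.
move=> u uv u10 /(recurrent_act (- g)); rewrite shift_actD addNr shift_act0.
exact: vmin.
Qed.

Lemma chosen_inj u v x : chosen u x -> chosen v x -> u = v.
Proof.
move=> [u10 ux umin] [v10 vx vmin]; apply: (pcan_inj pickleK).
case: (ltngtP (pickle u) (pickle v)) => // lt.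
  by case: (vmin u).
by case: (umin v).
Qed.

Lemma chosen_exists x : free_part x -> exists v, chosen v x.
Proof.
move=> /recurrent_exists[v [v10 vx]].
have ex : exists k, `[< exists v, [/\ pickle v = k, (sup_norm v <= 10)%N & recurrent v x] >].
  by exists (pickle v); apply/asboolP; exists v.
case: (ex_minnP ex) => _ /asboolP[u [<- u10 ux]] umin; exists u; split=> // t tu t10 tx.
have := umin (pickle t); rewrite leqNgt tu => /(_ _)/negP; apply=> //.
by apply/asboolP; exists t.
Qed.

Lemma centre_separated x : separated (centre x).
Proof.
move=> n a b [u [ua an]] [v [vb bn]] ab.
have : v = u.
  apply: (@chosen_inj _ _ (shift_act b x)) => //.
  by rewrite -[b](subrK a) -shift_actD; exact: chosen_act.
move=> vu; subst v; apply/esym/eqP; rewrite -subr_eq0; apply/eqP.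
apply: (@markers_separated (10 * rad n) _ (shift_act (u *+ rad n) (shift_act a x))) => //.
  by rewrite -/(dist b a) distC.
have -> : shift_act (b - a) (shift_act (u *+ rad n) (shift_act a x)) =
    shift_act (u *+ rad n) (shift_act b x).
  by rewrite !shift_actD addrAC subrK addrC.
exact: bn.
Qed.

(** The chosen vector serves some point [g] of the orbit at arbitrarily large
scales [n]; once [rad n] exceeds the norm of [g], the origin is served within
twice that radius. *)
Lemma centre_covering x : free_part x -> covering (centre x).
Proof.
move=> fx a; have [v va] := chosen_exists (free_part_act (g := a) fx).
have [_ [g gP] _] := va; have [n [w [gn wn wgn]]] := gP (sup_norm g).
exists n, (w + g + a); split.
  by exists v; rewrite -shift_actD; split=> //; exact: chosen_act.
rewrite distC /dist addrK.
by have := sup_normD w g; have := rad_gt n; lia.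
Qed.

Lemma centre_act g x : centre (shift_act g x) = translate (centre x) g.
Proof.
by apply/funext => n; apply/funext => a; rewrite /centre /translate shift_actD.
Qed.

Lemma borel_centre n a : @borel X (fun x => centre x n a).
Proof.
apply: (@borel_shift (fun x => exists v, chosen v x /\ moved_markers n v x)).
have bm k v : borel (moved_markers k v).
  by apply: borel_shift; exact: borel_markers.
have br v : borel (recurrent v).
  rewrite /recurrent; borel_connectives; exact: borel_shift.
by rewrite /chosen; borel_connectives.
Qed.

End ShiftAction.

(** * The homomorphism *)

(** Recording all possible heights at the origin, and choosing one from this finite
record, makes the choice Borel without a uniqueness proof for heights. *)
Definition profile (d : nat) (x : cantor_shift d) : {ffun 'Z_10 -> bool} :=
  [ffun v => `[< height (centre x) 0 v >]].

Definition colour (p : {ffun 'Z_10 -> bool}) : 'Z_5 :=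
  halve (odflt 0 [pick v | p v]).

Lemma borel_profile (d : nat) p : @borel (cantor_shift d) (fun x => profile x = p).
Proof.
rewrite (_ : (fun x => _) = fun x => forall v, `[< height (centre x) 0 v >] = p v).
  apply: borel_forall => v; case: (p v).
    rewrite (_ : (fun x => _) = fun x => height (centre x) 0 v).
      exact: (borel_height (@borel_centre d)).
    by apply/funext => x; apply/propext; split=> [/asboolP|?]; last exact/asboolP.
  rewrite (_ : (fun x => _) = fun x => ~ height (centre x) 0 v).
    by apply: borel_not; exact: (borel_height (@borel_centre d)).
  by apply/funext => x; apply/propext; split=> [/negbT/asboolPn|?]; last exact/asboolF.
apply/funext => x; apply/propext; split=> [<- v|xp]; first by rewrite ffunE.
by apply/ffunP => v; rewrite ffunE.
Qed.

Theorem theorem6p6 (n : nat) (hn : (1 < n)%N) :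
  exists f : free_shift n -> P5, borel_map f /\ digraph_hom (@schreier_arc n) P5_arc f.
Proof.
exists (fun x => colour (profile (set_val x))); split.
  move=> B _.
  apply: (@borel_preimage (free_shift n) (cantor_shift n) set_val
    (fun x => B (colour (profile x)))); first exact: initial_continuous.
  rewrite (_ : (fun x => _) = fun x => exists p, profile x = p /\ B (colour p)).
    by borel_connectives; exact: borel_profile.
  by apply/funext => x; apply/propext; split=> [?|[p [<-]]//]; exists (profile x).
have colourE (x : cantor_shift n) : free_part x ->
    exists2 v, height (centre x) 0 v & colour (profile x) = halve v.
  move=> fx; have [v hv] := height_exists 0 (centre_covering fx).
  rewrite /colour; case: pickP => [u|/(_ v)]; rewrite ffunE => /asboolP.
    by exists u.
  by [].
move=> x y [i xy].
have [v vx ->] := colourE (set_val x) (set_valP x).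
have [w wy ->] := colourE (set_val y) (set_valP y).
move: wy; rewrite xy centre_act => /height_translate wy.
have [s s24 ->] := height_step (@centre_separated n (set_val x)) (y := 0 + std_gen i) erefl vx wy.
exact: halve_arc.
Qed.
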